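(* Let $\mu\in\mathbb R$ and $\sigma>0$, $Q=N(\mu,\sigma^2)$, $P^*=N(0,\sigma^2+\mu^2)$, and $\mathcal N_{\mu=0}=\{N(0,\sigma_0^2):\sigma_0>0\}$. Then: (1) $P^*$ attains the minimum $$D_{\mathrm{KL}}(Q\,\|\,P^* )=\min_{P\in\mathcal N_{\mu=0}}D_{\mathrm{KL}}(Q\,\|\,P)=\frac12\log(1+\mu^2/\sigma^2).$$ (2) $M^*=\frac{\mathrm dQ}{\mathrm dP^*}(X_1)$ is an e-value for $\mathcal N_{\mu=0}$; thus it is the numeraire e-value, and $P^*$ is the reverse information projection of $Q$ onto $\mathcal N_{\mu=0}$. (3) Consequently, every e-value $M=M(X_1)$ for $\mathcal N_{\mu=0}$ satisfies $$\mathbb E_Q[\log M]\le\frac12\log(1+\mu^2/\sigma^2),$$ with equality if and only if $M=M^*$ ($Q$-almost surely).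
   Context: $N(\mu,\sigma^2)$ is the normal law with mean $\mu$, variance $\sigma^2$. An e-value (based on one observation $X_1$) for a class $\mathcal P$ of measures on $\mathbb R$ is a measurable $[0,\infty]$-valued function $M=M(X_1)$ with $\int M\,\mathrm dP\le1$ for all $P\in\mathcal P$. $\mathbb E_Q$ is expectation when $X_1\sim Q$. The bipolar $\mathcal P^{\circ\circ}$ is the set of all sub-probability measures $P$ on $\mathbb R$ such that every e-value for $\mathcal P$ satisfies $\int M\,\mathrm dP\le1$. $P^*$ is the reverse information projection of $Q$ onto $\mathcal P$ if $P^*\in\mathcal P^{\circ\circ}$ and $D_{\mathrm{KL}}(Q\|P^* )=\min_{P\in\mathcal P^{\circ\circ}}D_{\mathrm{KL}}(Q\|P)$, where $D_{\mathrm{KL}}(Q\|P)=\int\log\frac{\mathrm dQ}{\mathrm dP}\,\mathrm dQ$ if $Q\ll P$ and $+\infty$ otherwise. The numeraire e-value is the e-value $M^*=\frac{\mathrm dQ}{\mathrm dP^*}(X_1)$ for $\mathcal P$ that is optimal in the sense that $\mathbb E_Q[\log M]\le\mathbb E_Q[\log M^*]$ for every e-value $M$ for $\mathcal P$. *)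

(* Defs.v *)
From mathcomp Require Import all_boot all_order all_algebra.
From mathcomp Require Import all_classical all_reals all_analysis measurable_realfun.

Set Implicit Arguments.
Unset Strict Implicit.
Unset Printing Implicit Defensive.

Import Order.TTheory GRing.Theory Num.Theory.
Import numFieldNormedType.Exports.

Local Open Scope classical_set_scope.
Local Open Scope ring_scope.
Local Open Scope ereal_scope.

(* The everywhere nonnegative version of dQ/dP (equal to the constant -oo when
   Q is not absolutely continuous with respect to P).  The library's
   ['d Q '/d P] is stated for charges, and may be negative on a null set. *)
Definition density {d : measure_display} {T : measurableType d} {R : realType}
    (Q : probability T R) (P : subprobability T R) : T -> \bar R :=
  Radon_Nikodym_SigmaFinite.f Q P.

(* [lne 0 = -oo] and [lne +oo = +oo].  Should the positive and the negative part
   both have infinite integral, the library's value is -oo. *)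
Definition log_expectation {d : measure_display} {T : measurableType d} {R : realType}
    (Q : probability T R) (M : T -> \bar R) : \bar R :=
  \int[Q]_x lne (M x).

Definition kl {d : measure_display} {T : measurableType d} {R : realType}
    (Q : probability T R) (P : subprobability T R) : \bar R :=
  if `[< Q `<< P >] then log_expectation Q (density Q P) else +oo.

Definition evalue {d : measure_display} {T : measurableType d} {R : realType}
    (calP : set (subprobability T R)) (M : T -> \bar R) : Prop :=
  [/\ measurable_fun [set: T] M,
      forall x, 0 <= M x &
      forall P, calP P -> \int[P]_x M x <= 1].

Definition bipolar {d : measure_display} {T : measurableType d} {R : realType}
    (calP : set (subprobability T R)) : set (subprobability T R) :=
  [set P | forall M, evalue calP M -> \int[P]_x M x <= 1].

Definition attains_min {I : Type} {R : realType}
    (f : I -> \bar R) (A : set I) (x : I) : Prop :=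
  A x /\ forall y, A y -> f x <= f y.

Definition RIPr {d : measure_display} {T : measurableType d} {R : realType}
    (calP : set (subprobability T R)) (Q : probability T R)
    (Pstar : subprobability T R) : Prop :=
  attains_min (kl Q) (bipolar calP) Pstar.

(* "M = dQ/dP*" is understood up to a P*-null set. *)
Definition numeraire {d : measure_display} {T : measurableType d}
    {R : realType} (calP : set (subprobability T R)) (Q : probability T R)
    (M : T -> \bar R) : Prop :=
  [/\ evalue calP M,
      exists2 Pstar, RIPr calP Q Pstar &
        Q `<< Pstar /\ ae_eq Pstar [set: T] M (density Q Pstar) &
      forall M', evalue calP M' -> log_expectation Q M' <= log_expectation Q M].

(* [normal_prob m s] takes the standard deviation [s], not the variance. *)
Definition normal_law {R : realType} (m s : R) :
    probability (measurableTypeR R) R := normal_prob m s.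

Definition centered_normals (R : realType) :
    set (subprobability (measurableTypeR R) R) :=
  [set (normal_law 0 s0 : subprobability _ R) | s0 in [set s0 : R | (0 < s0)%R]].
Arguments centered_normals : clear implicits.

(* Main.v *)
Require Import Defs.
From mathcomp Require Import all_boot all_order all_algebra.
From mathcomp Require Import all_classical all_reals all_analysis measurable_realfun.
From mathcomp Require Import ring lra.
Import Order.TTheory GRing.Theory Num.Theory.
Import numFieldNormedType.Exports.
Local Open Scope classical_set_scope.
Local Open Scope ring_scope.
Local Open Scope ereal_scope.

(** For [D = dQ/dP], the tangent-line inequality [log y <= y - 1] at [y = M / D]
    gives [E_Q (log M) <= E_Q (log D) + (E_P M - 1)], with equality only if
    [M = D] Q-almost surely.  Hence as soon as [dQ/dPstar] is an e-value, it is the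
    numeraire (take [P = Pstar]) and [Pstar] is the reverse information projection
    (take [M = dQ/dPstar] and [P] in the bipolar).

    With [a], [b], [c] the precisions of [Q], [Pstar] and [N(0, t^2)], completing the
    square shows that the integral of [dQ/dPstar] under [N(0, t^2)] is
    [sqrt u * exp (- (u - 1) / 2)] with [u = a c / (b (a - b + c))], which is at
    most 1.  Finally [log (dQ/dPstar) = log (tau / sigma) + q] with [q] quadratic; the
    Laplace transform of [q] under [Q] is at most [exp (th^2)] near 0, which forces
    [q] to have mean 0 and yields the value of the divergence. *)

(** * The extended logarithm: measurability and tangent lines *)

Lemma measurable_lne (R : realType) : measurable_fun [set: \bar R] (@lne R).
Proof.
apply: (measurability _ (ErealGenCInfty.measurableE R)) => //.
move=> _ [_ [x ->] <-]; rewrite setTI.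
rewrite (_ : _ @^-1` _ = `[(expR x)%:E, +oo[%classic); first exact: emeasurable_itv.
apply/seteqP; split => -[r| |] /=; rewrite !in_itv/= ?andbT ?leey ?leNye//.
- case: ifPn => // r0; rewrite -ltNge in r0.
  by rewrite !lee_fin -{2}(@lnK _ r)// ler_expR.
- rewrite lee_fin => xr; have r0 := lt_le_trans (expR_gt0 x) xr.
  by rewrite (leNgt r) r0/= lee_fin -ler_expR lnK.
Qed.

(** This is [1 + t <= expR t] at [t = ln m - l]; the right-hand side is the tangent to [ln] at
    [expR l]. *)
Lemma lne_le_tangent (R : realType) (l : R) (m : \bar R) : 0 <= m ->
  lne m <= l%:E + (m * (expR (- l))%:E - 1).
Proof.
case: m => [m| |]//=; last first.
  by move=> _; rewrite gt0_mulye ?lte_fin ?expR_gt0// leey.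
move=> _; case: ifPn => [_|]; rewrite ?leNye// -ltNge => m0.
rewrite -EFinM -EFinB -EFinD lee_fin.
have := expR_ge1Dx (ln m - l); rewrite expRD (@lnK _ m)//; lra.
Qed.

(** Since [1 + t < expR t] for [t != 0], equality forces [ln m = l]. Finiteness excludes [m = +oo],
    where both sides are [+oo]. *)
Lemma lne_eq_tangent (R : realType) (l : R) (m : \bar R) : 0 <= m ->
  lne m \is a fin_num ->
  lne m = l%:E + (m * (expR (- l))%:E - 1) -> m = (expR l)%:E.
Proof.
case: m => [m| |]//= _; case: ifPn => //; rewrite -ltNge => m0 _.
rewrite -EFinM -EFinB -EFinD => -[] e.
suff ml : (ln m - l = 0)%R by congr EFin; rewrite -[in LHS](@lnK _ m)//; congr expR; lra.
apply: contrapT => /eqP /expR_gt1Dx; rewrite expRD (@lnK _ m)// => h.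
by move: h; lra.
Qed.

(** * Comparison of integrals that may be infinite *)

Section integral_order.
Context {d : measure_display} {T : measurableType d} {R : realType}.
Variable mu : {measure set T -> \bar R}.

(* No integrability is needed: [+oo - +oo = -oo] is compatible with the order. *)
Lemma ae_le_integral (f g : T -> \bar R) :
  measurable_fun [set: T] f -> measurable_fun [set: T] g ->
  {ae mu, forall x, f x <= g x} -> \int[mu]_x f x <= \int[mu]_x g x.
Proof.
move=> mf mg fg; rewrite (integralE _ _ f) (integralE _ _ g); apply: leeB.
- apply: ae_ge0_le_integral => //; try exact: measurable_funepos.
  by apply: filterS fg => x fgx _; rewrite !funeposE ge_max !le_max fgx/= lexx !orbT.
- apply: ae_ge0_le_integral => //; try exact: measurable_funeneg.
  apply: filterS fg => x fgx _.
  by rewrite !funenegE ge_max !le_max leeN2 fgx/= lexx !orbT.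
Qed.

(** Because [+oo - +oo = -oo], a finite value forces the positive and the negative part both to have
    finite integral. *)
Lemma integrable_fin_numP (f : T -> \bar R) : measurable_fun [set: T] f ->
  mu.-integrable [set: T] f <-> \int[mu]_x f x \is a fin_num.
Proof.
move=> mf; split => [|ff]; first exact: integrable_fin_num.
by apply/integrableP; split => //; apply/abse_integralP => //; rewrite -fin_num_abs.
Qed.

(** The difference [g \- f] is almost everywhere nonnegative with integral 0, so it vanishes; almost
    everywhere finiteness turns this into equality. *)
Lemma ae_le_integral_eq (f g : T -> \bar R) :
  mu.-integrable [set: T] f -> mu.-integrable [set: T] g ->
  {ae mu, forall x, f x <= g x} -> \int[mu]_x g x <= \int[mu]_x f x ->
  {ae mu, forall x, f x = g x}.
Proof.
move=> intf intg fg gf.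
have mgf : measurable_fun [set: T] (g \- f).
  exact: emeasurable_funB (measurable_int _ intg) (measurable_int _ intf).
have ff := integrable_ae measurableT intf.
have gfin := integrable_ae measurableT intg.
have : \int[mu]_x `|(g \- f) x| = 0.
  transitivity (\int[mu]_x (g \- f) x).
    apply: ae_eq_integral => //; first exact: measurableT_comp.
    by apply: filterS2 fg ff => x fgx /(_ I) fx _; rewrite gee0_abs// sube_ge0// fx.
  rewrite integralB//; apply/eqP; rewrite eq_le sube_le0 gf/= sube_ge0.
    exact: ae_le_integral (measurable_int _ intf) (measurable_int _ intg) fg.
  by rewrite integrable_fin_num.
move/(ae_eq_integral_abs mu measurableT mgf).
apply: filterS3 ff gfin => x /(_ I) fx /(_ I) gx /(_ I) /= gf0.
move: fx gx gf0; case: (f x) => [a| |]//; case: (g x) => [b| |]// _ _ [] /eqP.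
by rewrite subr_eq0 => /eqP ->.
Qed.

End integral_order.

(** * Gibbs inequality against a sub-probability, with its equality case *)

Section gibbs.
Context {d : measure_display} {T : measurableType d} {R : realType}.
Variables (Q : probability T R) (P : subprobability T R).
Hypothesis QP : Q `<< P.

Lemma density_ge0 x : 0 <= density Q P x.
Proof. exact: Radon_Nikodym_SigmaFinite.f_ge0. Qed.

Lemma density_fin_num x : density Q P x \is a fin_num.
Proof. exact: Radon_Nikodym_SigmaFinite.f_fin_num. Qed.

Lemma measurable_density : measurable_fun [set: T] (density Q P).
Proof. exact: measurable_int (Radon_Nikodym_SigmaFinite.f_integrable QP). Qed.

(** A real-valued log-density, usable as tangent point everywhere; it matches [lne (density Q P x)]
    only Q-almost everywhere. *)
Let l x := ln (fine (density Q P x)).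

Let ml : measurable_fun [set: T] l.
Proof.
by apply: measurableT_comp => //; apply: measurableT_comp measurable_density.
Qed.

(** The Q-mass of the zero set of the density is the integral of the density over that set. *)
Lemma ae_density_gt0 : {ae Q, forall x, 0 < density Q P x}.
Proof.
have mD := measurable_density.
have mN : measurable [set x | density Q P x <= 0].
  by rewrite -[X in measurable X]setTI; exact: emeasurable_fun_infty_c.
exists [set x | density Q P x <= 0]; split => //=; last first.
  by move=> x /= /negP; rewrite -leNgt.
rewrite (Radon_Nikodym_SigmaFinite.f_integral QP)//.
rewrite (eq_integral (cst 0)) ?integral0// => x; rewrite inE/= => Dx0.
by apply/eqP; rewrite eq_le Dx0 density_ge0.
Qed.

Let ae_densityE : {ae Q, forall x, density Q P x = (expR (l x))%:E}.
Proof.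
apply: filterS ae_density_gt0 => x Dx; rewrite /l lnK ?fineK ?density_fin_num//.
by rewrite posrE fine_gt0// Dx/= ltey_eq density_fin_num.
Qed.

Let ae_lne_density : {ae Q, forall x, lne (density Q P x) = (l x)%:E}.
Proof.
by apply: filterS ae_densityE => x ->; rewrite lne_EFin ?expR_gt0// expRK.
Qed.

Let measurable_lne_density : measurable_fun [set: T] (fun x => lne (density Q P x)).
Proof. exact: (measurableT_comp (@measurable_lne R)) measurable_density. Qed.

(* On the null set where the density vanishes, [l] takes the junk value
   [ln 0 = 0]; there [M * expR (- l) * density] is [0 <= M]. *)
Let integral_ratio_le (M : T -> \bar R) : measurable_fun [set: T] M ->
  (forall x, 0 <= M x) ->
  \int[Q]_x (M x * (expR (- l x))%:E) <= \int[P]_x M x.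
Proof.
move=> mM M0.
have mexp : measurable_fun [set: T] (fun x => (expR (- l x))%:E).
  by apply/measurable_EFinP; apply: measurableT_comp => //; exact: measurable_funN.
rewrite -(Radon_Nikodym_SigmaFinite.change_of_variables QP)//; last 2 first.
- by move=> x; rewrite mule_ge0// lee_fin expR_ge0.
- exact: emeasurable_funM.
apply: ge0_le_integral => //.
- by move=> x _; rewrite !mule_ge0// ?lee_fin ?expR_ge0//; exact: density_ge0.
- by apply: emeasurable_funM; [exact: emeasurable_funM|exact: measurable_density].
move=> x _; rewrite -muleA -[leRHS]mule1; apply: lee_wpmul2l => //.
rewrite -/(density Q P) -(fineK (density_fin_num x)) -EFinM lee_fin /l.
have [|D0] := leP (fine (density Q P x)) 0%R; last by rewrite expRN lnK// mulVf// gt_eqF.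
move=> D0; apply: (@le_trans _ _ 0%R) => //.
by rewrite mulr_ge0_le0// expR_ge0.
Qed.

(** From [l >= - expR (- l)], where [expR (- l)] has Q-integral at most the total mass of [P]. Hence
    the log-expectation of the density is finite or [+oo]. *)
Let integral_lne_density_lNy : -oo < \int[Q]_x lne (density Q P x).
Proof.
have mexp : measurable_fun [set: T] (fun x => (expR (- l x))%:E).
  by apply/measurable_EFinP; apply: measurableT_comp => //; exact: measurable_funN.
apply: (@lt_le_trans _ _ (\int[Q]_x - (expR (- l x))%:E)).
  rewrite integral_ge0N; last by move=> x _; rewrite lee_fin expR_ge0.
  have -> : \int[Q]_x (expR (- l x))%:E = \int[Q]_x (cst 1 x * (expR (- l x))%:E).
    by apply: eq_integral => x _; rewrite mul1e.
  rewrite ltNye; apply: contraTneq (integral_ratio_le (cst 1) _ _) => //.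
  move=> /eqP; rewrite eqe_oppLR/= => /eqP ->; rewrite -ltNge integral_cst// mul1e.
  by rewrite (le_lt_trans sprobability_setT)// ltry.
apply: ae_le_integral => //; first exact: measurableT_comp.
apply: filterS ae_lne_density => x ->.
by rewrite -EFinN lee_fin; have := expR_ge1Dx (- l x); lra.
Qed.

Let ratio_integrable (M : T -> \bar R) : measurable_fun [set: T] M ->
  (forall x, 0 <= M x) -> \int[P]_x M x <= 1 ->
  Q.-integrable [set: T] (fun x => M x * (expR (- l x))%:E).
Proof.
move=> mM M0 PM1.
apply/integrableP; split.
  apply: emeasurable_funM => //.
  by apply/measurable_EFinP; apply: measurableT_comp => //; exact: measurable_funN.
under eq_integral do rewrite gee0_abs ?mule_ge0// ?lee_fin ?expR_ge0//.
by rewrite (le_lt_trans (integral_ratio_le _ mM M0))// (le_lt_trans PM1)// ltry.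
Qed.

(** The function [g] is the tangent bound for [lne (M x)] at the density. A finite log-expectation
    makes [l] integrable, so the integral of [g] splits, and the term added to that of [l] is at
    most [\int[P]_x M x - 1]. *)
Let tangent_integral (M : T -> \bar R) : measurable_fun [set: T] M ->
  (forall x, 0 <= M x) -> \int[P]_x M x <= 1 ->
  \int[Q]_x lne (density Q P x) \is a fin_num ->
  let g := fun x => (l x)%:E + (M x * (expR (- l x))%:E - 1) in
  Q.-integrable [set: T] g /\ \int[Q]_x g x <= \int[Q]_x lne (density Q P x).
Proof.
move=> mM M0 PM1 Dfin g.
have intr := ratio_integrable _ mM M0 PM1.
have int1 : Q.-integrable [set: T] (cst 1) by exact: finite_measure_integrable_cst.
have mlE : measurable_fun [set: T] (EFin \o l) by exact/measurable_EFinP.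
have lE : \int[Q]_x lne (density Q P x) = \int[Q]_x (l x)%:E.
  by apply: ae_eq_integral => //; apply: filterS ae_lne_density.
have intl : Q.-integrable [set: T] (EFin \o l).
  by apply/integrable_fin_numP => //; rewrite -lE.
have intr1 : Q.-integrable [set: T] (fun x => M x * (expR (- l x))%:E - 1).
  exact: integrableB.
split; first exact: integrableD.
rewrite (integralD measurableT intl intr1) (integralB measurableT intr int1).
rewrite integral_cst//= probability_setT mule1 lE.
rewrite -[leRHS]adde0 leeD2lE; last by rewrite -lE.
rewrite sube_le0; exact: le_trans (integral_ratio_le _ mM M0) PM1.
Qed.

Lemma gibbs (M : T -> \bar R) : measurable_fun [set: T] M ->
  (forall x, 0 <= M x) -> \int[P]_x M x <= 1 ->
  log_expectation Q M <= log_expectation Q (density Q P).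
Proof.
move=> mM M0 PM1; rewrite /log_expectation.
have [Dfin|] := boolP (\int[Q]_x lne (density Q P x) \is a fin_num); last first.
  (* The value [-oo] is excluded by [integral_lne_density_lNy], which leaves [+oo]. *)
  by rewrite fin_numE gt_eqF//= negbK => /eqP ->; rewrite leey.
have [intg] := tangent_integral _ mM M0 PM1 Dfin; apply: le_trans.
apply: ae_le_integral (measurable_int _ intg) _ => //.
  exact: (measurableT_comp (@measurable_lne R)).
by apply: nearW => x; exact: lne_le_tangent.
Qed.

(** Equal log-expectations squeeze [lne (M x)] against its tangent bound, so the two agree almost
    everywhere and [lne_eq_tangent] applies. *)
Lemma gibbs_eq (M : T -> \bar R) : measurable_fun [set: T] M ->
  (forall x, 0 <= M x) -> \int[P]_x M x <= 1 ->
  log_expectation Q (density Q P) \is a fin_num ->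
  log_expectation Q M = log_expectation Q (density Q P) ->
  {ae Q, forall x, M x = density Q P x}.
Proof.
rewrite /log_expectation => mM M0 PM1 Dfin MD.
have [intg gD] := tangent_integral _ mM M0 PM1 Dfin.
have mlM : measurable_fun [set: T] (fun x => lne (M x)).
  exact: (measurableT_comp (@measurable_lne R)).
have intM : Q.-integrable [set: T] (fun x => lne (M x)).
  by apply/integrable_fin_numP => //; rewrite MD.
have Mg : {ae Q, forall x, lne (M x) = (l x)%:E + (M x * (expR (- l x))%:E - 1)}.
  apply: ae_le_integral_eq => //; last by rewrite MD.
  by apply: nearW => x; exact: lne_le_tangent.
apply: filterS3 Mg ae_densityE (integrable_ae measurableT intM).
by move=> x Mgx -> /(_ I) Mx; exact: lne_eq_tangent.
Qed.

End gibbs.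

(** * Optimality of the density once it is an e-value *)

Section density_numeraire.
Context {d : measure_display} {T : measurableType d} {R : realType}.
Variables (calP : set (subprobability T R)) (Q : probability T R).
Variable Pstar : subprobability T R.
Hypotheses (calPstar : calP Pstar) (QPstar : Q `<< Pstar).
Hypothesis evalue_density : evalue calP (density Q Pstar).

Lemma sub_bipolar : calP `<=` bipolar calP.
Proof. by move=> P calP_P M [_ _]; exact. Qed.

Lemma kl_density : kl Q Pstar = log_expectation Q (density Q Pstar).
Proof. by rewrite /kl; case: asboolP. Qed.

(** Here the e-value is fixed and the reference measure varies: bipolarity of [P] is exactly the
    integral bound that [gibbs] requires. *)
Lemma RIPr_density : RIPr calP Q Pstar.
Proof.
split=> [|P bipP]; first exact: sub_bipolar.
rewrite kl_density /kl; case: asboolP => [QP|_]; last by rewrite leey.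
have [mM M0 _] := evalue_density.
exact: gibbs (bipP _ evalue_density).
Qed.

Lemma evalue_log_expectation_le (M : T -> \bar R) : evalue calP M ->
  log_expectation Q M <= log_expectation Q (density Q Pstar).
Proof. by move=> [mM M0 calPM]; exact: gibbs (calPM _ calPstar). Qed.

Lemma numeraire_density : numeraire calP Q (density Q Pstar).
Proof.
split=> //; last exact: evalue_log_expectation_le.
by exists Pstar; [exact: RIPr_density|split => //; exact: ae_eq_refl].
Qed.

Lemma attains_min_kl_density : attains_min (kl Q) calP Pstar.
Proof. by split=> // P /sub_bipolar; have [_] := RIPr_density; exact. Qed.

Lemma log_expectation_eqP (M : T -> \bar R) : evalue calP M ->
  log_expectation Q (density Q Pstar) \is a fin_num ->
  log_expectation Q M = log_expectation Q (density Q Pstar) <->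
  {ae Q, forall x, M x = density Q Pstar x}.
Proof.
move=> [mM M0 calPM] Dfin; split; first exact: gibbs_eq (calPM _ calPstar) Dfin.
move=> MD; apply: ae_eq_integral => //.
- exact: (measurableT_comp (@measurable_lne R)).
- exact: (measurableT_comp (@measurable_lne R)) (measurable_density _ _ QPstar).
- by apply: filterS MD => x ->.
Qed.

End density_numeraire.

(** * Normal laws: integration, domination and density ratios *)

Section normal_integral.
Context {R : realType}.
Implicit Types (m s x : R).

(** Expressing the exponent through the precision [s ^- 2] turns later exponent computations into
    rational identities. *)
Lemma normal_pdf_expR m s x : (0 < s)%R ->
  normal_pdf m s x =
    ((Num.sqrt (pi *+ 2))^-1 * s^-1 * expR (- (s ^- 2 * (x - m) ^+ 2 / 2)))%R.
Proof.
move=> s0; rewrite normal_pdfE ?gt_eqF// /normal_peak /normal_fun; congr (_ * _)%R.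
  rewrite -mulrnAr sqrtrM ?sqr_ge0// sqrtr_sqr gtr0_norm//.
  by rewrite invfM mulrC.
by congr expR; rewrite -mulr_natr invfM; ring.
Qed.

Lemma normal_pdf_gt0 m s x : (0 < s)%R -> (0 < normal_pdf m s x)%R.
Proof.
move=> s0; rewrite normal_pdf_expR// !mulr_gt0 ?expR_gt0// invr_gt0//.
by rewrite sqrtr_gt0 mulrn_wgt0// pi_gt0.
Qed.

(** The Radon-Nikodym derivative and [normal_pdf] have the same integral over every measurable
    subset of [A], hence agree almost everywhere on [A]. *)
Lemma ge0_integral_normal m s (A : set (measurableTypeR R))
    (f : measurableTypeR R -> \bar R) :
  measurable A -> measurable_fun A f -> (forall x, 0 <= f x) ->
  \int[normal_law m s]_(x in A) f x =
  \int[lebesgue_measure]_(x in A) (f x * (normal_pdf m s x)%:E).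
Proof.
move=> mA mf f0.
have dom : normal_law m s `<< (@lebesgue_measure R) by exact: normal_prob_dominates.
have mpdf : measurable_fun [set: measurableTypeR R] (fun x => (normal_pdf m s x)%:E).
  by apply/measurable_EFinP; exact: measurable_normal_pdf.
rewrite -(Radon_Nikodym_SigmaFinite.change_of_variables dom)//.
have mD := measurable_int _ (Radon_Nikodym_SigmaFinite.f_integrable dom).
apply: ae_eq_integral => //.
- by apply: emeasurable_funM => //; exact: measurable_funTS.
- by apply: emeasurable_funM => //; exact: measurable_funTS.
apply: ae_eqe_mul2l; apply: (@integral_ae_eq _ _ _ lebesgue_measure A mA) => //.
- apply: (integrableS measurableT) => //.
  exact: Radon_Nikodym_SigmaFinite.f_integrable.
- exact: measurable_funTS.
by move=> E EA mE; rewrite -Radon_Nikodym_SigmaFinite.f_integral.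
Qed.

(** Domination passes through Lebesgue measure: since the pdf is positive everywhere, a null set of
    [normal_law m s] is Lebesgue-null. *)
Lemma normal_law_dominates m s m' s' : (0 < s)%R ->
  normal_law m' s' `<< normal_law m s.
Proof.
move=> s0; apply: null_dominates_trans (@normal_prob_dominates R m' s') _.
apply/null_content_dominatesP => A mA NA0.
have mpdf : measurable_fun A (fun x => (normal_pdf m s x)%:E).
  by apply: measurable_funTS; apply/measurable_EFinP; exact: measurable_normal_pdf.
have : \int[lebesgue_measure]_(x in A) `|(normal_pdf m s x)%:E| = 0.
  rewrite -[RHS]NA0; apply: eq_integral => x _.
  by rewrite gee0_abs// lee_fin normal_pdf_ge0.
move/(ae_eq_integral_abs lebesgue_measure mA mpdf) => [N [mN N0 AN]].
apply/eqP; rewrite -measure_le0 -N0 le_measure ?inE// => x Ax; apply: AN => /=.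
move=> /(_ Ax) [] e; by have := normal_pdf_gt0 m s x s0; rewrite e ltxx.
Qed.

(** Integrating the quotient against [normal_law m s] cancels the denominator, so both functions
    have the same integral over every measurable set. *)
Lemma density_normalE m s m' s' : (0 < s)%R -> (0 < s')%R ->
  ae_eq (normal_law m s) [set: measurableTypeR R]
    (density (normal_law m' s') (normal_law m s))
    (fun x => (normal_pdf m' s' x / normal_pdf m s x)%:E).
Proof.
move=> s0 s'0.
have dom := normal_law_dominates m s m' s' s0.
have mM : measurable_fun [set: measurableTypeR R]
    (fun x => (normal_pdf m' s' x / normal_pdf m s x)%:E).
  apply/measurable_EFinP.
  (* Positivity lets the reciprocal be written as [expR (- ln y)], a composition of measurable
     maps. *)
  rewrite (_ : (fun x => _) =
    (fun x => normal_pdf m' s' x * expR (- ln (normal_pdf m s x))))%R; last first.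
    by apply/funext => x; rewrite expRN lnK// posrE normal_pdf_gt0.
  apply: measurable_funM; first exact: measurable_normal_pdf.
  apply: measurableT_comp => //; apply: measurable_funN.
  by apply: measurableT_comp => //; exact: measurable_normal_pdf.
apply: integral_ae_eq => //.
  exact: Radon_Nikodym_SigmaFinite.f_integrable.
move=> A _ mA; rewrite -Radon_Nikodym_SigmaFinite.f_integral//.
rewrite ge0_integral_normal//; last 2 first.
- exact: measurable_funTS.
- by move=> x; rewrite lee_fin divr_ge0 ?normal_pdf_ge0.
apply: eq_integral => x _; rewrite -EFinM divfK//.
by rewrite gt_eqF// normal_pdf_gt0.
Qed.

End normal_integral.

(** * Gaussian integrals of exponentials of quadratics *)

(** The square root of [u <= expR (u - 1)]. It absorbs the normalizing factor of the Gaussian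
    integrals into the exponent. *)
Lemma sqrtr_le_expR (R : realType) (u : R) : (Num.sqrt u <= expR ((u - 1) / 2))%R.
Proof.
have -> : (expR ((u - 1) / 2) = Num.sqrt (expR (u - 1)) :> R)%R.
  rewrite -[LHS]ger0_norm ?expR_ge0// -sqrtr_sqr expr2 -expRD.
  by congr (Num.sqrt (expR _)); field.
rewrite ler_wsqrtr//; have := expR_ge1Dx (u - 1)%R; lra.
Qed.

(* Completing the square: the integrand times the normal density is a multiple of
   another normal density. *)
Lemma integral_normal_expR_quadratic (R : realType) (m s al be ga : R) :
  (0 < s)%R -> (0 < s ^- 2 - 2 * al)%R ->
  \int[normal_law m s]_x (expR (al * x ^+ 2 + be * x + ga))%:E =
  (Num.sqrt (s ^- 2 / (s ^- 2 - 2 * al)) *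
   expR ((s ^- 2 * m + be) ^+ 2 / (2 * (s ^- 2 - 2 * al)) + ga
         - s ^- 2 * m ^+ 2 / 2))%:E.
Proof.
move=> s0; set A := (s ^- 2 - 2 * al)%R => A0.
set K := (_ * expR _)%R.
have mexp : measurable_fun [set: measurableTypeR R]
    (fun x => (expR (al * x ^+ 2 + be * x + ga))%:E).
  apply/measurable_EFinP; apply: measurableT_comp => //.
  apply: measurable_funD => //; apply: measurable_funD.
    by apply: measurable_funM => //; exact: measurable_funX.
  exact: measurable_funM.
rewrite ge0_integral_normal//.
(* The new normal density has precision [A], mean [B / A] and standard deviation [s']. *)
pose B := (s ^- 2 * m + be)%R; pose s' := (Num.sqrt A)^-1%R.
have s'0 : (0 < s')%R by rewrite invr_gt0 sqrtr_gt0.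
have As' : (s' ^- 2 = A)%R by rewrite /s' exprVn invrK sqr_sqrtr// ltW.
transitivity (\int[lebesgue_measure]_x (K%:E * (normal_pdf (B / A) s' x)%:E)); last first.
  rewrite ge0_integralZl//.
  - by rewrite integral_normal_pdf mule1.
  - by apply/measurable_EFinP; exact: measurable_normal_pdf.
  - by move=> x _; rewrite lee_fin normal_pdf_ge0.
  - by rewrite lee_fin mulr_ge0 ?expR_ge0// sqrtr_ge0.
apply: eq_integral => x _; rewrite -!EFinM; congr EFin.
rewrite !normal_pdf_expR// As' /K.
have -> : (Num.sqrt (s ^- 2 / A) = s^-1 * s')%R.
  by rewrite sqrtrM ?invr_ge0 ?sqr_ge0// !sqrtrV ?sqr_ge0 ?ltW// sqrtr_sqr gtr0_norm.
have -> : (expR (al * x ^+ 2 + be * x + ga) * ((Num.sqrt (pi *+ 2))^-1 / s *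
    expR (- (s ^- 2 * (x - m) ^+ 2 / 2))) = ((Num.sqrt (pi *+ 2))^-1 / s *
  expR (al * x ^+ 2 + be * x + ga - s ^- 2 * (x - m) ^+ 2 / 2)))%R.
  by rewrite [in RHS]expRD; ring.
transitivity ((Num.sqrt (pi *+ 2))^-1 / s * (s' / s') *
   expR ((s ^- 2 * m + be) ^+ 2 / (2 * A) + ga - s ^- 2 * m ^+ 2 / 2
         - A * (x - B / A) ^+ 2 / 2))%R; last by rewrite [in LHS]expRD; ring.
rewrite divff ?mulr1 ?gt_eqF//; congr (_ * expR _)%R.
have alE : al = ((s ^- 2 - A) / 2)%R by rewrite /A; field; rewrite gt_eqF.
rewrite alE /B; field.
by rewrite (gt_eqF A0) gt_eqF.
Qed.

(** * The e-value property and the divergence for the normal pair *)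

Section normal_numeraire.
Context {R : realType}.
Variables (mu sigma : R).
Hypothesis sigma_gt0 : (0 < sigma)%R.

Let tau := Num.sqrt (sigma ^+ 2 + mu ^+ 2).
Let a := (sigma ^- 2)%R.
Let b := (tau ^- 2)%R.
(** The expansion of [b * x ^+ 2 / 2 - a * (x - mu) ^+ 2 / 2]: the log-ratio of the two densities
    without its constant. *)
Let q (x : R) := ((b - a) / 2 * x ^+ 2 + a * mu * x + - (a * mu ^+ 2 / 2))%R.

Let tau2_gt0 : (0 < sigma ^+ 2 + mu ^+ 2)%R.
Proof. apply: ltr_wpDr; [exact: sqr_ge0|exact: exprn_gt0]. Qed.

Let tau_gt0 : (0 < tau)%R.
Proof. by rewrite sqrtr_gt0. Qed.

Let a_gt0 : (0 < a)%R.
Proof. by rewrite invr_gt0 exprn_gt0. Qed.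

Let b_gt0 : (0 < b)%R.
Proof. by rewrite invr_gt0 exprn_gt0. Qed.

(** The variances differ by [mu ^+ 2], that is [1 / b - 1 / a = mu ^+ 2]. The exponent identities
    below are reduced to multiples of this one. *)
Let abmu : (a * b * mu ^+ 2 = a - b)%R.
Proof.
rewrite /a /b /tau sqr_sqrtr; last exact: ltW.
by field; rewrite gt_eqF// gt_eqF.
Qed.

Let b_le_a : (b <= a)%R.
Proof. by rewrite -subr_ge0 -abmu mulr_ge0 ?sqr_ge0// mulr_ge0// ltW. Qed.

Let normal_pdf_ratio x :
  (normal_pdf mu sigma x / normal_pdf 0 tau x = tau / sigma * expR (q x))%R.
Proof.
have c0 : (Num.sqrt (pi *+ 2) != 0 :> R)%R.
  by rewrite gt_eqF// sqrtr_gt0 mulrn_wgt0// pi_gt0.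
rewrite !normal_pdf_expR// -/a -/b.
have -> : (q x = - (a * (x - mu) ^+ 2 / 2) - (- (b * (x - 0) ^+ 2 / 2)))%R.
  by rewrite /q; field.
set X := (- (a * _ / 2))%R; set Y := (- (b * _ / 2))%R.
move: X Y => X Y; rewrite expRD expRN; field.
by rewrite c0 !gt_eqF ?expR_gt0.
Qed.

Let tau_sigma : (tau / sigma = Num.sqrt (a / b))%R.
Proof.
rewrite -[LHS]ger0_norm ?divr_ge0 ?ltW// -sqrtr_sqr; congr Num.sqrt.
by rewrite /a /b; field; rewrite !gt_eqF.
Qed.

Let measurable_q (th : R) :
  measurable_fun [set: measurableTypeR R] (fun x => th * q x)%R.
Proof.
apply: measurable_funM => //; apply: measurable_funD => //; apply: measurable_funD.
  by apply: measurable_funM => //; exact: measurable_funX.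
exact: measurable_funM.
Qed.

Let integral_ratio_le1 (t : R) : (0 < t)%R ->
  \int[normal_law 0 t]_x (tau / sigma * expR (q x))%:E <= 1.
Proof.
move=> t0; under eq_integral do rewrite EFinM.
rewrite ge0_integralZl//; last 2 first.
- apply/measurable_EFinP; apply: measurableT_comp => //.
  by have := measurable_q 1; under eq_fun do rewrite mul1r.
- by rewrite lee_fin divr_ge0 ?ltW.
pose c := (t ^- 2)%R.
have c0 : (0 < c)%R by rewrite invr_gt0 exprn_gt0.
have AE : (c - 2 * ((b - a) / 2) = a - b + c)%R by field.
have A0 : (0 < a - b + c)%R by rewrite ltr_wpDl// subr_ge0.
have ab0 : (0 <= a / b)%R by rewrite divr_ge0 ?ltW.
rewrite /q integral_normal_expR_quadratic//; last by rewrite -/c AE.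
rewrite -/c AE -EFinM lee_fin tau_sigma mulrA -(sqrtrM _ ab0).
set u := (a / b * (c / (a - b + c)))%R.
have -> : ((c * 0 + a * mu) ^+ 2 / (2 * (a - b + c)) - a * mu ^+ 2 / 2
    - c * 0 ^+ 2 / 2 = - ((u - 1) / 2))%R.
  apply/eqP; rewrite -subr_eq0; apply/eqP.
  (* The difference is affine in [mu ^+ 2]; its slope divided by [a * b] gives the cofactor. *)
  transitivity ((b - c) / (2 * b * (a - b + c)) * (a * b * mu ^+ 2 - (a - b)))%R.
    by rewrite /u; field; rewrite !gt_eqF.
  by rewrite abmu subrr mulr0.
by rewrite expRN ler_pdivrMr ?expR_gt0// mul1r sqrtr_le_expR.
Qed.

(** For such [th] the new precision [A] is at least [a / 2]. After [sqrtr_le_expR] the terms of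
    first order in [th] cancel by [abmu], leaving [th ^+ 2 * ((a - b) / (2 * A))], where
    [a - b <= 2 * A]. *)
Let integral_expR_le (th : R) : (`|th| <= 2^-1)%R ->
  \int[normal_law mu sigma]_x (expR (th * q x))%:E <= (expR (th ^+ 2))%:E.
Proof.
rewrite ler_norml => /andP[th1 th2].
pose A := (a + th * (a - b))%R.
have aA : (a / 2 <= A)%R.
  have : (0 <= (th + 2^-1) * (a - b))%R by apply: mulr_ge0; [lra|rewrite subr_ge0].
  by move: b_gt0; rewrite /A mulrDl; lra.
have A0 : (0 < A)%R by rewrite (lt_le_trans _ aA)// divr_gt0.
have AE : (a - 2 * (th * ((b - a) / 2)) = A)%R by rewrite /A; field.
have qE x : (th * q x = th * ((b - a) / 2) * x ^+ 2 + th * (a * mu) * x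
    + th * - (a * mu ^+ 2 / 2))%R by rewrite /q; ring.
under eq_integral do rewrite qE.
rewrite integral_normal_expR_quadratic//; last by rewrite -/a AE.
rewrite -/a AE lee_fin.
apply: le_trans (ler_wpM2r (expR_ge0 _) (sqrtr_le_expR _ _)) _.
rewrite -expRD ler_expR.
rewrite [leLHS](_ : _ = th ^+ 2 * ((a - b) / (2 * A)))%R.
  rewrite ler_piMr ?sqr_ge0// ler_pdivrMr ?mulr_gt0// mul1r; move: b_gt0; lra.
apply/eqP; rewrite -subr_eq0; apply/eqP.
transitivity ((th * (1 + th)) / (2 * A) * (a * b * mu ^+ 2 - (a - b)))%R.
  by rewrite /A; field; rewrite -/A gt_eqF.
by rewrite abmu subrr mulr0.
Qed.

Let integrable_expR_q (th : R) : (`|th| <= 2^-1)%R ->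
  (normal_law mu sigma).-integrable [set: measurableTypeR R]
    (fun x => (expR (th * q x))%:E).
Proof.
move=> thh; apply/integrableP; split.
  by apply/measurable_EFinP; apply: measurableT_comp => //; exact: measurable_q.
under eq_integral do rewrite gee0_abs ?lee_fin ?expR_ge0//.
by rewrite (le_lt_trans (integral_expR_le th thh))// ltry.
Qed.

(** Dominated by [2 * (expR (q / 2) + expR (- q / 2))], whose terms are integrable at the endpoints
    [th = 1/2] and [th = - 1/2]. *)
Let integrable_q :
  (normal_law mu sigma).-integrable [set: measurableTypeR R] (fun x => (q x)%:E).
Proof.
have h1 : (`|2^-1| <= 2^-1 :> R)%R by rewrite ger0_norm// invr_ge0.
have h2 : (`|- 2^-1| <= 2^-1 :> R)%R by rewrite normrN.
have := integrableD measurableT (integrable_expR_q _ h1) (integrable_expR_q _ h2).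
move=> /(integrableZl measurableT 2%R); apply: le_integrable => //.
  by have := measurable_q 1; under eq_fun do rewrite mul1r; move/measurable_EFinP.
move=> x _; rewrite /= lee_fin [leRHS]ger0_norm; last first.
  by rewrite mulr_ge0// addr_ge0 ?expR_ge0.
have e1 := expR_ge1Dx (2^-1 * q x); have e2 := expR_ge1Dx (- 2^-1 * q x).
have e3 := expR_ge0 (2^-1 * q x); have e4 := expR_ge0 (- 2^-1 * q x).
by rewrite ler_norml; apply/andP; split; lra.
Qed.

(* From [1 + th * q <= expR (th * q)], the mean of [q] satisfies
   [th * mean <= 2 * th ^+ 2] for all small [th] of either sign. *)
Let integral_q : \int[normal_law mu sigma]_x (q x)%:E = 0.
Proof.
have Qfin := integrable_fin_num measurableT integrable_q.
rewrite -(fineK Qfin); congr EFin.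
set e := fine _.
have key (th : R) : (`|th| <= 2^-1 -> th * e <= 2 * th ^+ 2)%R.
  move=> thh; have h4 : (th ^+ 2 <= 4^-1)%R.
    rewrite -real_normK ?num_real//; have := normr_ge0 th; nra.
  have : (1 + th * e <= expR (th ^+ 2))%R.
    rewrite -lee_fin; apply: le_trans (integral_expR_le th thh).
    rewrite EFinD EFinM fineK//.
    rewrite -(integralZl measurableT integrable_q th).
    have int1 : (normal_law mu sigma).-integrable [set: measurableTypeR R]
      (cst 1%:E) by exact: finite_measure_integrable_cst.
    have intZ := integrableZl measurableT th integrable_q.
    have -> : 1%:E = \int[normal_law mu sigma]_x (cst 1%:E x).
      by rewrite integral_cst//= probability_setT mule1.
    rewrite -(integralD measurableT int1 intZ).
    apply: (@le_integral _ _ _ (normal_law mu sigma)) => //; first exact: integrableD.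
      exact: integrable_expR_q.
    by move=> x _; rewrite /= -EFinM -EFinD lee_fin expR_ge1Dx.
  move: h4 (sqr_ge0 th); set z := (th ^+ 2)%R => z4 z0 h.
  (* For [z] in [[0, 1/4]], [expR z <= 1 / (1 - z) <= 1 + 2 * z]. *)
  have Ez : (expR z * (1 - z) <= 1)%R.
    by rewrite mulrC -ler_pdivlMr ?expR_gt0// div1r -expRN expR_ge1Dx.
  have : (expR z <= 1 + 2 * z)%R.
    have z1 : (0 < 1 - z)%R by lra.
    rewrite -(ler_pM2r z1); apply: le_trans Ez _; nra.
  lra.
(* Taking [th = k * e] in [key] gives [k * e ^+ 2 <= 2 * k ^+ 2 * e ^+ 2]. The choice of [k] ensures
   [|k * e| <= 1/2] and [2 * k < 1], so [e = 0]. *)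
pose k := (4 * (1 + `|e|))^-1%R.
have e0 := normr_ge0 e.
have k0 : (0 < k)%R by rewrite invr_gt0 mulr_gt0// ltr_pwDl.
have ke : (k * `|e| <= 4^-1)%R.
  by rewrite /k mulrC ler_pdivrMr ?mulr_gt0// ?ltr_pwDl//; lra.
have k4 : (k <= 4^-1)%R.
  by rewrite lef_pV2 ?posrE ?mulr_gt0// ?ltr_pwDl//; lra.
have kek : (`|k * e| <= 2^-1)%R by rewrite normrM gtr0_norm//; lra.
have kk0 : (0 < k * (1 - 2 * k))%R by apply: mulr_gt0 => //; lra.
have : (k * (1 - 2 * k) * e ^+ 2 <= 0)%R.
  rewrite (_ : _ * e ^+ 2 = k * e * e - 2 * (k * e) ^+ 2)%R; last by ring.
  by rewrite subr_le0 key.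
rewrite pmulr_rle0// => e2_le0; apply/eqP.
by rewrite -sqrf_eq0 eq_le sqr_ge0 andbT.
Qed.

Let Q := normal_law mu sigma.
Let Pstar := normal_law 0 tau.

(** Stated under an arbitrary normal law because it serves both under the centered laws and under
    [Q]. *)
Let densityE (t m : R) : (0 < t)%R ->
  ae_eq (normal_law m t) [set: measurableTypeR R] (density Q Pstar)
    (fun x => (tau / sigma * expR (q x))%:E).
Proof.
move=> t0; apply: (@null_dominates_ae_eq _ _ _ _ _ Pstar) => //.
  exact: normal_law_dominates.
by apply: filterS (density_normalE 0 tau mu sigma tau_gt0 sigma_gt0) => x /[apply] ->;
  rewrite normal_pdf_ratio.
Qed.

Lemma evalue_normal_density : evalue (centered_normals R) (density Q Pstar).
Proof.
have dom : Q `<< Pstar by exact: normal_law_dominates.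
split; [exact: measurable_density|exact: density_ge0|].
move=> _ [t /= t0 <-].
suff <- : \int[normal_law 0 t]_x (tau / sigma * expR (q x))%:E =
    \int[normal_law 0 t]_x density Q Pstar x by exact: integral_ratio_le1.
apply: ge0_ae_eq_integral => //.
- apply/measurable_EFinP; apply: measurable_funM => //; apply: measurableT_comp => //.
  by have := measurable_q 1; under eq_fun do rewrite mul1r.
- exact: measurable_density.
- by move=> x _; rewrite lee_fin mulr_ge0 ?expR_ge0// divr_ge0// ltW.
- by move=> x _; exact: density_ge0.
- exact/ae_eq_sym/densityE.
Qed.

Lemma log_expectation_normal_density : log_expectation Q (density Q Pstar) =
  (2^-1 * ln (1 + mu ^+ 2 / sigma ^+ 2))%:E.
Proof.
have dom : Q `<< Pstar by exact: normal_law_dominates.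
have ts0 : (0 < tau / sigma)%R by rewrite divr_gt0.
have int1 : Q.-integrable [set: measurableTypeR R] (cst (ln (tau / sigma))%:E).
  exact: finite_measure_integrable_cst.
rewrite /log_expectation.
transitivity (\int[Q]_x (cst (ln (tau / sigma))%:E x + (q x)%:E)).
  apply: ae_eq_integral => //.
  - exact: (measurableT_comp (@measurable_lne R)) (measurable_density _ _ dom).
  - exact: emeasurable_funD (measurable_int _ int1) (measurable_int _ integrable_q).
  apply: filterS (densityE sigma mu sigma_gt0) => x /(_ I) -> _.
  have e0 := expR_gt0 (q x); rewrite lne_EFin; last exact: mulr_gt0.
  by rewrite lnM ?posrE// expRK.
rewrite (integralD measurableT int1 integrable_q) [X in _ + X]integral_q adde0.
rewrite integral_cst//= probability_setT mule1; congr EFin.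
(* The square produces a factor 2 in the logarithm, which cancels [2^-1]. *)
have -> : (1 + mu ^+ 2 / sigma ^+ 2 = (tau / sigma) ^+ 2)%R.
  by rewrite exprMn /tau sqr_sqrtr ?ltW// exprVn; field; rewrite gt_eqF.
by rewrite lnXn// -mulr_natr; field.
Qed.

End normal_numeraire.

(** * Specialization of the abstract optimality results to the normal pair *)

Theorem propositionC3 (R : realType) (mu sigma : R) (sigma_gt0 : (0 < sigma)%R) :
  let Q := normal_law mu sigma in
  let Pstar := normal_law 0 (Num.sqrt (sigma ^+ 2 + mu ^+ 2)) in
  let N0 := centered_normals R in
  let Mstar := density Q Pstar in
  let v := (2^-1 * ln (1 + mu ^+ 2 / sigma ^+ 2))%R%:E in
  [/\ attains_min (kl Q) N0 Pstar /\ kl Q Pstar = v,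
      [/\ evalue N0 Mstar, numeraire N0 Q Mstar & RIPr N0 Q Pstar] &
      forall M : measurableTypeR R -> \bar R, evalue N0 M ->
        log_expectation Q M <= v /\
        (log_expectation Q M = v <-> {ae Q, forall x, M x = Mstar x})].
Proof.
move=> Q Pstar N0 Mstar v.
have tau_gt0 : (0 < Num.sqrt (sigma ^+ 2 + mu ^+ 2))%R.
  by rewrite sqrtr_gt0; apply: ltr_wpDr; [exact: sqr_ge0|exact: exprn_gt0].
have N0Pstar : N0 Pstar by exists (Num.sqrt (sigma ^+ 2 + mu ^+ 2)).
have dom : Q `<< Pstar by exact: normal_law_dominates.
have evMstar : evalue N0 Mstar by exact: evalue_normal_density.
have vE : log_expectation Q Mstar = v by exact: log_expectation_normal_density.
split.
- by rewrite kl_density//; split => //; exact: attains_min_kl_density.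
- by split; [|exact: numeraire_density|exact: RIPr_density].
- move=> M evM; rewrite -vE; split; first exact: evalue_log_expectation_le evM.
  by apply: log_expectation_eqP evM _ => //; rewrite -/Mstar vE.
Qed.
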